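(* Let $Y$ be a real topological vector space, $f:Y\to\overline{\mathbb{R}}$, $A:=\operatorname{epi}f\subseteq Y\times\mathbb{R}$ and $k:=(0_Y,-1)\in Y\times\mathbb{R}$. Then: (a) $f$ is lower semicontinuous if and only if $\varphi_{A,k}$ is lower semicontinuous. (b) $f$ is continuous if and only if $\varphi_{A,k}$ is continuous.
   Context: $\overline{\mathbb{R}}=\mathbb{R}\cup\{-\infty,+\infty\}$ with its usual order topology, $\inf\emptyset=+\infty$, $\operatorname{epi}f=\{(y,t)\in Y\times\mathbb{R}:f(y)\le t\}$. The Gerstewitz functional $\varphi_{A,k}:Y\times\mathbb{R}\to\overline{\mathbb{R}}$ is $\varphi_{A,k}((y,s))=\inf\{t\in\mathbb{R}:(y,s)\in A+tk\}$; $Y\times\mathbb{R}$ carries the product topology. *)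

(* Defs.v *)
From mathcomp Require Import all_boot all_order all_algebra.
From mathcomp Require Import all_classical all_reals ereal topology normedtype.

Set Implicit Arguments.
Unset Strict Implicit.
Unset Printing Implicit Defensive.

Import Order.TTheory GRing.Theory Num.Theory.
Import numFieldNormedType.Exports.

Local Open Scope classical_set_scope.
Local Open Scope ring_scope.

(* The real line is taken as R^o, so that the product Y * R^o is a real vector
   space; its topology is the product topology. *)
Definition epi (R : realType) (Y : Type) (f : Y -> \bar R) : set (Y * R^o) :=
  [set z | (f z.1 <= z.2%:E)%E].

(* ereal_inf is the infimum in \bar R, with ereal_inf set0 = +oo. *)
Definition gerstewitz (R : realType) (Z : lmodType R) (A : set Z) (k : Z)
    (z : Z) : \bar R :=
  ereal_inf [set t%:E | t in [set t : R | [set a + t *: k | a in A] z]].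

(* Main.v *)
Require Import Defs.
From mathcomp Require Import all_boot all_order all_algebra.
From mathcomp Require Import all_classical all_reals ereal topology normedtype.

Import Order.TTheory GRing.Theory Num.Theory.
Import numFieldNormedType.Exports.

Local Open Scope classical_set_scope.
Local Open Scope ring_scope.

(** The point (y, s) lies in epi f + t (0, -1) exactly when f y <= s + t, so
    the Gerstewitz functional is (y, s) |-> f y - s. It inherits semicontinuity
    and continuity from f, and f is recovered as its restriction to s = 0. *)

(** Only real [t] are allowed, so infinite [w] need care: for [+oo] the upper bound is trivial, and
    for [-oo] the set is the whole real line, which is unbounded below. A real [w] is itself a
    member. *)
Lemma ereal_inf_EFin_ge (R : realType) (w : \bar R) :
  ereal_inf [set t%:E | t in [set t : R | (w <= t%:E)%E]] = w.
Proof.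
apply/eqP; rewrite eq_le; apply/andP; split; last first.
  by apply/ereal_infP => _ [t /= wt <-].
case: w => [r| |]; [|exact: leey|].
  by apply: ereal_inf_lbound; exists r => /=.
rewrite (_ : [set t : R | _] = setT) ?ereal_inf_real//.
by apply/seteqP; split => // t _ /=; rewrite leNye.
Qed.

Lemma gerstewitz_epiE (R : realType) (Y : lmodType R) (f : Y -> \bar R) :
  gerstewitz (epi f : set (Y * R^o)) (0, -1) =
  (fun z => f z.1 - z.2%:E)%E.
Proof.
(* With the right-hand side also written as an infimum over reals, it suffices to compare the two
   sets of [t]. *)
apply/funext => -[y s] /=; rewrite -[RHS]ereal_inf_EFin_ge /gerstewitz.
congr (ereal_inf (_ @` _)); apply/seteqP; split => t /=.
- case=> -[y' s']; rewrite /epi /= => fs' [<- <-].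
  rewrite scaler0 addr0 EFinN leeBlDr//; apply: (le_trans fs').
  by rewrite -EFinD lee_fin scalerN /GRing.scale/= mulr1 addrC subrK.
(* The witness is forced: it is [(y, s) - t *: (0, -1)]. *)
- rewrite EFinN leeBlDr// => fs; exists (y, t + s) => //.
  congr pair => /=; first by rewrite scaler0 addr0.
  by rewrite scalerN /GRing.scale/= mulr1 addrC addKr.
Qed.

Lemma lower_semicontinuous_comp (R : realType) (X Z : topologicalType)
    (g : X -> Z) (f : Z -> \bar R) :
  continuous g -> lower_semicontinuous f -> lower_semicontinuous (f \o g).
Proof.
move=> cg lf x a /lf[V gxV Vf]; exists (g @^-1` V); first exact: cg.
by move=> y /Vf.
Qed.

(** A real [b] strictly between [a + g x] and [f x] separates the two conditions: near [x], both
    [b < f y] and [g y < b - a] hold, whence [a + g y < f y]. *)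
Lemma lower_semicontinuous_subEFin (R : realType) (X : topologicalType)
    (f : X -> \bar R) (g : X -> R) : lower_semicontinuous f -> continuous g ->
  lower_semicontinuous (fun x => f x - (g x)%:E)%E.
Proof.
move=> lf cg x a; rewrite lteBrDr// -EFinD => agf.
have [b agb bf] : exists2 b : R, a + g x < b & (b%:E < f x)%E.
  (* The value [-oo] contradicts [agf]; a midpoint serves for a real value, and any larger real for
     [+oo]. *)
  case: (f x) agf => [r| |] //=.
    rewrite lte_fin => agr; exists ((a + g x + r) / 2).
      by rewrite midf_lt.
    by rewrite lte_fin midf_lt.
  by exists (a + g x + 1); rewrite ?ltrDl ?ltry.
have [V xV Vf] := lf x b bf.
exists (V `&` [set y | g y < b - a]).
  apply: filterI => //; apply: (cg x [set r | r < b - a]).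
  by apply: lt_nbhsl; rewrite ltrBrDl.
move=> y [/Vf bfy gb]; rewrite lteBrDr//; apply: le_lt_trans bfy.
by rewrite -EFinD lee_fin -lerBrDl; exact: ltW.
Qed.

Lemma continuous_subEFin (R : realType) (X : topologicalType)
    (f : X -> \bar R) (g : X -> R) : continuous f -> continuous g ->
  continuous (fun x => f x - (g x)%:E)%E.
Proof.
(* Since [g x] is real, the difference is never of the form [oo - oo], even where [f] is
   infinite. *)
move=> cf cg x; apply: cvgeB; [exact: fin_num_adde_defl|exact: cf|].
by apply: cvg_EFin; [exact: nearW|exact: cg].
Qed.

Theorem proposition21 (R : realType) (Y : topologicalLmodType R)
    (f : Y -> \bar R) :
  let A : set (Y * R^o) := epi f in
  let k : Y * R^o := (0, -1) in
  (lower_semicontinuous f <-> lower_semicontinuous (gerstewitz A k)) /\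
  (continuous f <-> continuous (gerstewitz A k)).
Proof.
move=> A k; rewrite /A /k gerstewitz_epiE.
have cfst : continuous (fst : Y * R^o -> Y) by move=> z; exact: cvg_fst.
have csnd : continuous (snd : Y * R^o -> R) by move=> z; exact: cvg_snd.
(* Continuity of this section reduces both converse implications to composition. *)
have cpair : continuous (fun y : Y => (y, 0 : R^o)).
  by move=> y; exact: (cvg_pair cvg_id (cvg_cst (0 : R^o))).
have fE : f = (fun z : Y * R^o => f z.1 - z.2%:E)%E \o (fun y => (y, 0 : R^o)).
  by apply/funext => y /=; rewrite sube0.
split; split.
- move=> lf; apply: lower_semicontinuous_subEFin csnd.
  exact: lower_semicontinuous_comp cfst lf.
- by move=> lg; rewrite fE; exact: lower_semicontinuous_comp cpair lg.
- move=> cf; have cff : continuous (f \o fst : Y * R^o -> \bar R).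
    by move=> z; apply: continuous_comp; [exact: cfst|exact: cf].
  exact: continuous_subEFin cff csnd.
- move=> cg; rewrite fE => y.
  by apply: continuous_comp; [exact: cpair|exact: cg].
Qed.
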